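(* Let $s\ge 1$ be an integer and let $\mathbf p\in(0,1)$ be a fixed position (not depending on $n$). For integers $n>s$ and $v>0$ let $\Omega$, $\mathbf c=\mathbf c(\mathbf p,n)$, $A=A(\mathbf p,v,n)$ be as in the context, let $$Z = Z_s\oplus Z_s,\qquad Z_s=\begin{bmatrix} I_s & 0\\ 0& 0_{n-s}\end{bmatrix}\in\mathbb R^{n\times n},$$ and let $X(\mathbf p,v,s)\in\mathbb R^{2n\times 2n}$ (which also depends on $n$) be the solution of the Lyapunov equation $$A\,X(\mathbf p,v,s)+X(\mathbf p,v,s)\,A^T=-Z .$$ Let $v_{\rm opt}=\operatorname{argmin}_{v}\operatorname{trace}(X(\mathbf p,v,s))$ (minimum over $v>0$) be the optimal viscosity for the position $\mathbf p$ and the given $s$. Then $$\lim_{n\to\infty}\frac{\operatorname{trace}\big(X(\mathbf p,v_{\rm opt},s)\big)}{n}=\eta_1(\mathbf p,s),$$ where $\eta_1(\mathbf p,s)$ is a function that is independent of $n$.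
   Context: Discrete mass–spring chain with unit masses and unit stiffnesses and one damper, written in modal coordinates. For $n\in\mathbb N$ set $$\omega_j=\omega_j(n)=2\sin\frac{j\pi}{2(n+1)},\quad j=1,\dots,n,\qquad \Omega=\operatorname{diag}(\omega_1,\dots,\omega_n).$$ For a position $\mathbf p\in(0,1)$ (a damper at the $k$-th mass corresponds to $\mathbf p=k/n$) the damping vector is $\mathbf c=\mathbf c(\mathbf p,n)=[c_1,\dots,c_n]^T$ with $$c_j=c_j(\mathbf p,n)=\sqrt{\tfrac{2}{n+1}}\,\sin\frac{j\,\mathbf p\, n\,\pi}{n+1},\qquad j=1,\dots,n.$$ For a viscosity $v>0$, $$A=\begin{bmatrix}0&\Omega\\ -\Omega& -v\,\mathbf c\,\mathbf c^T\end{bmatrix}\in\mathbb R^{2n\times 2n}.$$ Standing assumption: $c_j(\mathbf p,n)\ne 0$ for all $j=1,\dots,n$; only dimensions $n$ for which this holds are considered. The symbol $\oplus$ denotes the block-diagonal direct sum of matrices, $I_m$ and $0_m$ the $m\times m$ identity and zero matrices.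
   Formalization: The limit η₁(p,s) is taken in the extended reals and is claimed finite only when sin(jpπ)≠0 for all 1≤j≤s; otherwise (p=a/b in lowest terms with b≤s, e.g. p=1/2, s=2) the limit is +∞, so a real-valued η₁ for every p is impossible. *)

(* Defs.v *)
From HB Require Import structures.
From mathcomp Require Import all_boot all_order all_algebra.
From mathcomp Require Import all_classical all_reals all_analysis.

Import Order.TTheory GRing.Theory Num.Theory.
Import numFieldNormedType.Exports.

Local Open Scope classical_set_scope.
Local Open Scope ring_scope.

Section MassSpringChain.
Context {R : realType}.
Implicit Types (n s j : nat) (p v : R).

Definition omega n j : R := 2 * sin (j%:R * pi / (2 * n.+1%:R)).

Definition damping n p j : R :=
  Num.sqrt (2 / n.+1%:R) * sin (j%:R * p * n%:R * pi / n.+1%:R).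

(* Modes are numbered 1..n, hence the shift i.+1 of the indices i : 'I_n. *)
Definition Omega n : 'M[R]_n := diag_mx (\row_(i < n) omega n i.+1).

Definition damping_vec n p : 'cV[R]_n := \col_(i < n) damping n p i.+1.

Definition Amx n p v : 'M[R]_(n + n) :=
  block_mx 0 (Omega n)
           (- Omega n) (- v *: (damping_vec n p *m (damping_vec n p)^T)).

Definition Zmx n s : 'M[R]_(n + n) :=
  block_mx (pid_mx s) 0 0 (pid_mx s).

Definition lyapunov_sols n p v s : set 'M[R]_(n + n) :=
  [set X | Amx n p v *m X + X *m (Amx n p v)^T = - Zmx n s].

(* The equation has a unique solution when v > 0 and the dimension is
   admissible; the default value 0 is only there to make the function total. *)
Definition Xsol n p v s : 'M[R]_(n + n) := xget 0 (lyapunov_sols n p v s).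

Definition optimal_viscosities n p s : set R :=
  [set v | 0 < v /\
           forall w : R, 0 < w -> \tr (Xsol n p v s) <= \tr (Xsol n p w s)].

(* As for Xsol, the default 0 is not reached in the admissible dimensions
   n > s with s >= 1: there the minimizer exists and is unique. *)
Definition vopt n p s : R := xget 0 (optimal_viscosities n p s).

(* No mode is undamped.  For each p in (0, 1) infinitely many n satisfy this:
   all n >= 1 if p is irrational, all n multiple of a if p = a / b. *)
Definition admissible p n : Prop :=
  forall j, (1 <= j <= n)%N -> damping n p j != 0.

(* p is not a node of one of the first s modes sin (j * pi * x) of the limiting
   string.  If p is such a node, i.e. if p = a / b in lowest terms with b <= s,
   then damping n p b is nonzero in admissible dimensions but of order
   n `^ (- 3 / 2), and the minimal trace grows like n ^ 2. *)
Definition nonnodal p s : Prop :=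
  forall j, (1 <= j <= s)%N -> sin (j%:R * p * pi) != 0.

End MassSpringChain.

(* Main.v *)
Require Import Defs.
From HB Require Import structures.
From mathcomp Require Import all_boot all_order all_algebra.
From mathcomp Require Import all_classical all_reals all_analysis.
From mathcomp Require Import zify ring lra.
Import Order.TTheory GRing.Theory Num.Theory.
Import numFieldNormedType.Exports.
Local Open Scope classical_set_scope.
Local Open Scope ring_scope.

(** Off the diagonal the blocks of the Lyapunov equation decouple into 2 x 2
  systems, so that [X] is explicit for the right-hand side [- (D ⊕ D)], [D]
  diagonal, and its trace has the form [a / v + K v] with
  [a = 2 * sum_(m <= s) 1 / c_m ^ 2]; the optimum is [2 sqrt (a K)].  Partial
  fractions reduce [K] to sums over [j] of powers of
  [1 / (omega_j ^ 2 - omega_m ^ 2)], weighted by [c_j ^ 2] or [1].  With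
  [N = n + 1], [N ^ 2 omega_j ^ 2] tends to [(j pi) ^ 2] and [N c_j ^ 2] to
  [2 sin (j p pi) ^ 2], and the rescaled sums are dominated by a multiple of
  [sum 1 / j ^ 2], so [K / N] converges by Tannery's theorem, as does [a / N]
  unless [p] is a node of one of the first [s] modes.  At a node [a / N] tends
  to [+oo] while [K / N] stays bounded below. *)

(** * Explicit solution of the Lyapunov equation and duality for its trace *)

Section Lyapunov.
Set Implicit Arguments.
Unset Strict Implicit.
Context {R : realFieldType} {n : nat}.
Variables (w c : 'I_n -> R).
Implicit Types (v : R) (D : 'I_n -> R) (X Z : 'M[R]_(n + n)).

Definition chain v : 'M[R]_(n + n) :=
  block_mx 0 (diag_mx (\row_i w i)) (- diag_mx (\row_i w i))
    (- v *: ((\col_i c i) *m (\col_i c i)^T)).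

Definition solves v Z X := chain v *m X + X *m (chain v)^T = - Z.

Definition dblock D : 'M[R]_(n + n) :=
  block_mx (diag_mx (\row_i D i)) 0 0 (diag_mx (\row_i D i)).

(* The solution is [[P, Q], [Q^T, S]], and [g = Q c].  The diagonal entries of the
   equation force those of [Q] and, through [(S c)_i = D_i / (v c_i)], those of
   [S]; the off-diagonal ones are 2 x 2 linear systems for [(Q_ij, Q_ji)] and for
   [(P_ij, S_ij)]. *)
Definition solQ D i j : R :=
  if i == j then - D i / (2 * w i)
  else - w i * (c i * (D j / c j) + D i / c i * c j) / (w i ^+ 2 - w j ^+ 2).

Definition solg D i : R := \sum_j solQ D i j * c j.

Definition solS_off v D i j : R :=
  v * (w i * solg D i * c j - w j * solg D j * c i) / (w i ^+ 2 - w j ^+ 2).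

Definition solS v D i j : R :=
  if i == j then D i / (v * c i ^+ 2) - \sum_(k | k != i) solS_off v D i k * c k / c i
  else solS_off v D i j.

Definition solP v D i j : R :=
  if i == j then solS v D i i - v * solg D i * c i / w i
  else v * (w j * solg D i * c j - w i * solg D j * c i) / (w i ^+ 2 - w j ^+ 2).

Definition sol v D : 'M[R]_(n + n) :=
  block_mx (\matrix_(i, j) solP v D i j) (\matrix_(i, j) solQ D i j)
    (\matrix_(i, j) solQ D j i) (\matrix_(i, j) solS v D i j).

Hypothesis w_neq0 : forall i, w i != 0.
Hypothesis c_neq0 : forall i, c i != 0.
Hypothesis w_inj : forall i j, i != j -> w i ^+ 2 - w j ^+ 2 != 0.

Lemma solSC v D i j : solS v D i j = solS v D j i.
Proof.
rewrite /solS eq_sym; case: eqVneq => [->//|ne]; rewrite /solS_off.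
field; rewrite w_inj //=; first by rewrite w_inj // eq_sym.
Qed.

(** The diagonal entries of [solS] are defined by solving this row identity for them, so the other
    terms of the row cancel. *)
Lemma solS_c v D i : v != 0 -> \sum_j solS v D i j * c j = D i / (v * c i).
Proof.
move=> v0; rewrite (bigD1 i) //= /solS eqxx mulrBl mulr_suml.
rewrite -addrA [X in _ + X](_ : _ = 0) ?addr0; first by field; rewrite v0 c_neq0.
rewrite addrC -sumrB big1 // => j ji; rewrite eq_sym (negbTE ji).
by field; rewrite c_neq0.
Qed.

Lemma cc_mul (M : 'M[R]_n) i j :
  (((\col_i c i) *m (\col_i c i)^T) *m M) i j = c i * \sum_k c k * M k j.
Proof.
rewrite -mulmxA mxE big_ord1 mxE mxE; congr (_ * _).
by apply: eq_bigr => k _; rewrite !mxE.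
Qed.

Lemma mul_cc (M : 'M[R]_n) i j :
  (M *m ((\col_i c i) *m (\col_i c i)^T)) i j = (\sum_k M i k * c k) * c j.
Proof.
rewrite mulmxA mxE big_ord1 !mxE; congr (_ * _).
by apply: eq_bigr => k _; rewrite !mxE.
Qed.

Lemma entry_add (A B : 'M[R]_n) i j : (A + B) i j = A i j + B i j.
Proof. by rewrite mxE. Qed.

Lemma entry_opp (A : 'M[R]_n) i j : (- A) i j = - A i j.
Proof. by rewrite mxE. Qed.

Lemma entry_scale a (A : 'M[R]_n) i j : (a *: A) i j = a * A i j.
Proof. by rewrite mxE. Qed.

Lemma entry_diag_mul (d : 'I_n -> R) (A : 'M[R]_n) i j :
  (diag_mx (\row_i d i) *m A) i j = d i * A i j.
Proof. by rewrite mul_diag_mx !mxE. Qed.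

Lemma entry_mul_diag (d : 'I_n -> R) (A : 'M[R]_n) i j :
  (A *m diag_mx (\row_i d i)) i j = A i j * d j.
Proof. by rewrite mul_mx_diag !mxE. Qed.

Definition entryE :=
  (entry_add, entry_opp, entry_scale, entry_diag_mul, entry_mul_diag, cc_mul, mul_cc).

Lemma tr_chain v : (chain v)^T =
  block_mx 0 (- diag_mx (\row_i w i)) (diag_mx (\row_i w i))
    (- v *: ((\col_i c i) *m (\col_i c i)^T)).
Proof.
rewrite /chain tr_block_mx trmx0 linearN /= tr_diag_mx linearZ /= trmx_mul.
by rewrite trmxK.
Qed.

Lemma sol_solves v D : v != 0 -> solves v (dblock D) (sol v D).
Proof.
move=> v0; rewrite /solves tr_chain /chain /sol /dblock !mulmx_block.
rewrite !add_block_mx opp_block_mx !(mul0mx, mulmx0, oppr0, add0r, addr0).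
rewrite !mulNmx !mulmxN -!scalemxAl -!scalemxAr.
congr block_mx; apply/matrixP => i j; rewrite !entryE !mxE.
- rewrite /solQ eq_sym; case: eqVneq => [->|ne] /=; first by field; rewrite w_neq0.
  by rewrite mulr0n; field; rewrite !w_inj // ?w_neq0 ?c_neq0 //= eq_sym.
- under eq_bigr do rewrite mxE.
  rewrite -/(solg D i) /solP; case: eqVneq => [<-|ne].
    by field; rewrite w_neq0.
  by rewrite /solS (negbTE ne) /solS_off; field; rewrite w_inj.
- under eq_bigr do rewrite mxE mulrC.
  rewrite -/(solg D j) /solP; case: eqVneq => [<-|ne].
    by field; rewrite w_neq0.
  by rewrite /solS (negbTE ne) /solS_off; field; rewrite w_inj.
(* [S] enters the lower right block only through [S c] and its transpose, which [solSC] and [solS_c]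
   evaluate; what remains is an identity in [Q]. *)
- under [X in c i * X]eq_bigr do rewrite mxE mulrC solSC.
  under [X in X * c j]eq_bigr do rewrite mxE.
  rewrite !solS_c // /solQ eq_sym; case: eqVneq => [->|ne] /=.
    by rewrite mulr1n; field; rewrite w_neq0 v0 c_neq0.
  by rewrite mulr0n; field; rewrite !w_inj // ?w_neq0 ?c_neq0 ?v0 //= eq_sym.
Qed.

(* Duality: with [J = I ⊕ - I] one has [J A J = A^T], so that the solution [Y] of
   the adjoint equation with right-hand side [- I] gives [tr X = tr (Y Z)]. *)
Lemma trace_lyapunov v Z X : v != 0 -> solves v Z X ->
  \tr X = \tr (block_mx 1%:M 0 0 (- 1%:M) *m sol v (fun=> 1)
                 *m block_mx 1%:M 0 0 (- 1%:M) *m Z).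
Proof.
move=> v0 XZ; set J := block_mx _ _ _ _.
have JJ : J *m J = 1%:M.
  rewrite mulmx_block !(mul0mx, mulmx0, addr0, add0r, mul1mx, mulNmx, mulmxN, opprK).
  by rewrite -scalar_mx_block.
have JA : J *m chain v *m J = (chain v)^T.
  rewrite tr_chain !mulmx_block !(mul0mx, mulmx0, addr0, add0r, mul1mx, mulmx1).
  by rewrite !(mulNmx, mulmxN, mul1mx, mulmx1, opprK, oppr0).
have JAt : J *m (chain v)^T *m J = chain v.
  by rewrite -JA !mulmxA JJ mul1mx -mulmxA JJ mulmx1.
set Y := J *m _ *m J.
have YA : (chain v)^T *m Y + Y *m chain v = - 1%:M.
  have /(congr1 (fun M => J *m M *m J)) := sol_solves (fun=> 1) v0.
  rewrite mulmxDr mulmxDl.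
  have -> : dblock (fun=> 1) = 1%:M.
    rewrite /dblock (_ : diag_mx _ = 1%:M) -?scalar_mx_block //.
    by rewrite -diag_const_mx; congr diag_mx; apply/matrixP => i j; rewrite !mxE.
  rewrite mulmxN mulNmx mulmx1 JJ => <-; congr (_ + _).
    by rewrite -JA /Y !mulmxA -(mulmxA _ J J) JJ mulmx1.
  by rewrite -[in LHS]JAt /Y !mulmxA -(mulmxA _ J J) JJ mulmx1.
clearbody Y.
have trN (M : 'M[R]_(n + n)) : \tr (- M) = - \tr M by exact: raddfN.
(* Substituting [Z = - (A X + X A^T)], cyclicity of the trace gives
   [tr (Y Z) = - tr ((A^T Y + Y A) X) = tr X]. *)
rewrite -[Z in RHS]opprK -XZ mulmxN trN mulmxDr mxtraceD.
rewrite (mulmxA Y X) (mxtrace_mulC (Y *m X)) !mulmxA -mxtraceD -mulmxDl.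
by rewrite addrC YA mulNmx mul1mx trN opprK.
Qed.

(** Duality makes the trace of any solution a linear functional of the right-hand side, which
    reduces the computation to the indicator of a single mode [m]. *)
Lemma sol_trace_linear v D X : v != 0 -> solves v (dblock D) X ->
  \tr X = \sum_m D m * \tr (sol v (fun i => (i == m)%:R)).
Proof.
move=> v0 /trace_lyapunov ->//; set M := (X in \tr (X *m _)).
have -> : dblock D = \sum_m D m *: dblock (fun i => (i == m)%:R).
  rewrite /dblock; under eq_bigr do rewrite scale_block_mx !scaler0.
  have -> : diag_mx (\row_i D i) =
      \sum_m D m *: diag_mx (\row_i (i == m)%:R) :> 'M[R]_n.
    apply/matrixP => i j; rewrite summxE !mxE (bigD1 i) //= !mxE eqxx.
    rewrite big1 ?addr0; first by rewrite mulrnAr mulr1.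
    by move=> k ki; rewrite !mxE eq_sym (negbTE ki) mul0rn mulr0.
  elim/big_ind2: _ => //; first by rewrite block_mx0.
  by move=> A A' B B' <- <-; rewrite add_block_mx !addr0.
rewrite mulmx_sumr raddf_sum; apply: eq_bigr => m _ /=.
rewrite -scalemxAr mxtraceZ; congr (_ * _).
by rewrite -(trace_lyapunov v0 (sol_solves _ v0)).
Qed.

End Lyapunov.

(** * Partial fractions for the coefficient of the viscosity *)

Section Cost.
Context {R : realFieldType} {I : finType}.
Set Implicit Arguments.
Unset Strict Implicit.
Implicit Types (l a x : I -> R) (m : I) (e : nat).

Definition divsum l x m e : R := \sum_(j | j != m) x j / (l j - l m) ^+ e.

(** The coefficient of [v] in the trace when only mode [m] is weighted, with [l = w ^ 2] and
    [a = c ^ 2]; see [sol_trace]. *)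
Definition cost l a m : R :=
  4 * l m * divsum l a m 2 + divsum l a m 1 + 2 * l m * divsum l a m 1 ^+ 2 / a m
  + a m * divsum l (fun=> 1) m 1 + 2 * l m * a m * divsum l (fun=> 1) m 2
  + a m / (2 * l m).

(* Completing the square in [divsum l a m 1]. *)
Lemma cost_ge l a m : (forall i, 0 < l i) -> (forall i, 0 < a i) ->
  (forall i, i != m -> l i - l m != 0) -> 3 / 8 * (a m / l m) <= cost l a m.
Proof.
move=> l0 a0 ne; rewrite -subr_ge0.
suff -> : cost l a m - 3 / 8 * (a m / l m) =
    4 * l m * divsum l a m 2
    + 2 * l m / a m * (divsum l a m 1 + a m / (4 * l m)) ^+ 2
    + a m * \sum_(j | j != m) (l j + l m) / (l j - l m) ^+ 2.
  have [lm am] := (l0 m, a0 m).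
  have U0 : 0 <= divsum l a m 2.
    by apply: sumr_ge0 => j _; rewrite divr_ge0 ?sqr_ge0 ?ltW.
  have V0 : 0 <= \sum_(j | j != m) (l j + l m) / (l j - l m) ^+ 2.
    by apply: sumr_ge0 => j _; rewrite divr_ge0 ?sqr_ge0 ?addr_ge0 ?ltW.
  by rewrite !addr_ge0 // mulr_ge0 ?sqr_ge0 // ?divr_ge0 ?mulr_ge0 // ltW.
have -> : \sum_(j | j != m) (l j + l m) / (l j - l m) ^+ 2 =
    divsum l (fun=> 1) m 1 + 2 * l m * divsum l (fun=> 1) m 2.
  rewrite mulr_sumr -big_split; apply: eq_bigr => j jm /=.
  by rewrite expr1; field; rewrite ne.
by rewrite /cost; field; rewrite !gt_eqF.
Qed.

(** Off [m] one has [h_i = - 1 - l_m / (l_i - l_m)], so for distinct [i], [k] other than [m] the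
    divided difference factors as [l_m / ((l_i - l_m) (l_k - l_m))], and the double sum collapses to
    products of single sums. *)
Lemma divided_difference_sum l a m (h : I -> R) :
  (forall i, l i != 0) -> (forall i, a i != 0) ->
  (forall i j, i != j -> l i - l j != 0) ->
  h m = - (1 / 2) + l m * divsum l a m 1 / a m ->
  (forall i, i != m -> h i = - l i / (l i - l m)) ->
  2 * (\sum_i \sum_(k | k != i) a k * (h i - h k) / (l i - l k))
    + \sum_i h i * a i / l i = - cost l a m.
Proof.
move=> l0 a0 ne hm hi; rewrite (bigD1 m) //=.
under [X in 2 * (_ + X)]eq_bigr => i im.
  rewrite (bigD1 m) 1?eq_sym //=.
  have -> : \sum_(k | (k != i) && (k != m)) a k * (h i - h k) / (l i - l k) =
      l m / (l i - l m) * (divsum l a m 1 - a i / (l i - l m)).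
    rewrite [in RHS]/divsum [in RHS](bigD1 i) //= expr1 addrAC subrr add0r mulr_sumr.
    apply: eq_big => [k|k /andP[ki km]]; first by rewrite andbC.
    by rewrite !hi // expr1; field; rewrite !ne // eq_sym.
  over.
rewrite [\sum_i h i * a i / l i](bigD1 m) //=.
have -> : \sum_(i | i != m) h i * a i / l i = - divsum l a m 1.
  rewrite /divsum -sumrN; apply: eq_bigr => i im; rewrite hi // expr1.
  by field; rewrite ne ?l0.
rewrite -big_split /=.
(* In the terms with [k = m], the part [l_m * divsum l a m 1 / a_m] of [h m] cancels the
   [divsum l a m 1] coming from the factored inner sums. *)
rewrite (_ : \sum_(i | i != m) _ = 
   \sum_(i | i != m) (- (1 / 2 + l m * divsum l a m 1 / a m) * (a i / (l i - l m) ^+ 1)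
     - 2 * l m * (a i / (l i - l m) ^+ 2) - a m / 2 * (1 / (l i - l m) ^+ 1)
     - l m * a m * (1 / (l i - l m) ^+ 2))); last first.
  apply: eq_bigr => i im; rewrite hm hi // !expr1.
  by field; rewrite !ne ?a0 // eq_sym.
rewrite !sumrB -!mulr_sumr -!/(divsum _ _ _ _) /cost hm.
have one e : divsum l (fun=> 1) m e = \sum_(i | i != m) (l i - l m) ^- e.
  by apply: eq_bigr => i _; rewrite mul1r.
by rewrite !one; field; rewrite ?a0 ?l0.
Qed.

End Cost.

(** * Trace of the solution for one mode *)

Section SolTrace.
Context {R : realFieldType} {n : nat}.
Set Implicit Arguments.
Unset Strict Implicit.
Variables (w c : 'I_n -> R).
Hypothesis w_neq0 : forall i, w i != 0.
Hypothesis c_neq0 : forall i, c i != 0.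
Hypothesis w_inj : forall i j, i != j -> w i ^+ 2 - w j ^+ 2 != 0.

Lemma sol_trace v m : v != 0 ->
  \tr (sol w c v (fun i => (i == m)%:R)) =
  2 / c m ^+ 2 / v + cost (fun i => w i ^+ 2) (fun i => c i ^+ 2) m * v.
Proof.
move=> v0; set D := fun i => _; set l := fun i => w i ^+ 2; set a := fun i => c i ^+ 2.
(* With [g_i = c_i h_i / w_i], the entry [(i, k)] of [solS_off] becomes [v c_i c_k] times the
   divided difference of [h] with respect to [l], so the trace takes the form treated by
   [divided_difference_sum]. *)
pose h i := solg w c D i * w i / c i.
have Dm : D m = 1 by rewrite /D eqxx.
have Dn i : i != m -> D i = 0 by rewrite /D => /negbTE ->.
have hm : h m = - (1 / 2) + l m * divsum l a m 1 / a m.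
  have -> : divsum l a m 1 = \sum_(j | j != m) c m / w m * (solQ w c D m j * c j).
    apply: eq_bigr => j jm; rewrite /solQ eq_sym (negbTE jm) Dm Dn // /l /a expr1.
    by field; rewrite ?w_inj ?c_neq0 ?w_neq0 // eq_sym.
  rewrite -mulr_sumr /h /solg (bigD1 m) //= {1}/solQ eqxx Dm /l /a.
  by field; rewrite c_neq0 w_neq0.
have hi i : i != m -> h i = - l i / (l i - l m).
  move=> im; rewrite /h /solg (bigD1 m) //= big1 => [|j jm].
    rewrite /solQ (negbTE im) Dm (Dn i) // /l.
    by field; rewrite w_inj ?c_neq0.
  rewrite /solQ (Dn i) // (Dn j) // oppr0 !mul0r addr0 !mulr0 mul0r.
  by case: eqVneq => _; rewrite ?mul0r ?mulr0.
have gE i : solg w c D i = c i / w i * h i.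
  by rewrite /h; field; rewrite w_neq0 c_neq0.
have := @divided_difference_sum _ _ l a m h _ _ w_inj hm hi.
move=> /(_ _ _)/(congr1 -%R); rewrite opprK => <-; last 2 first.
- by move=> i; rewrite expf_neq0.
- by move=> i; rewrite expf_neq0.
rewrite mxtrace_block -big_split mulNr mulr_sumr -big_split mulr_suml /=.
have -> : 2 / c m ^+ 2 / v = \sum_i 2 * (D i / (v * c i ^+ 2)).
  rewrite (bigD1 m) //= big1 => [|i im]; last by rewrite Dn // mul0r mulr0.
  by rewrite Dm addr0; field; rewrite v0 c_neq0.
rewrite -sumrB; apply: eq_bigr => i _ /=.
rewrite !mxE /solP /solS !eqxx gE.
have -> : \sum_(k | k != i) solS_off w c v D i k * c k / c i =
   v * \sum_(k | k != i) a k * (h i - h k) / (l i - l k).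
  rewrite mulr_sumr; apply: eq_bigr => k ki; rewrite /solS_off !gE /l /a.
  by field; rewrite !w_neq0 w_inj ?c_neq0 // eq_sym.
by rewrite /l /a; field; rewrite v0 w_neq0 c_neq0.
Qed.

End SolTrace.

(** * Optimal viscosity of the chain *)

Section Viscosity.
Context {R : realType}.
Set Implicit Arguments.
Unset Strict Implicit.
Implicit Types (n s j : nat) (p v : R).

Lemma omega_angle n j : (1 <= j <= n)%N ->
  0 < (j%:R : R) * pi / (2 * n.+1%:R) < pi / 2.
Proof.
move=> /andP[j1 jn]; have p0 := pi_gt0 R.
rewrite divr_gt0 ?mulr_gt0 ?ltr0n //= ltr_pdivrMr ?mulr_gt0 ?ltr0n //.
have : (j%:R : R) < n.+1%:R by rewrite ltr_nat.
by move: (_%:R) (_%:R) => x y; nra.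
Qed.

Lemma omega_gt0 n j : (1 <= j <= n)%N -> 0 < omega n j :> R.
Proof. by move=> /omega_angle /sin_gt0_pihalf ?; rewrite mulr_gt0. Qed.

Lemma omega_inj n i j : (1 <= i <= n)%N -> (1 <= j <= n)%N ->
  omega n i = omega n j :> R -> i = j.
Proof.
move=> hi hj /(mulfI _) eq_sin; have := eq_sin _ => /(_ _)/sin_inj.
have p0 := pi_gt0 R.
have itv k : (1 <= k <= n)%N -> k%:R * pi / (2 * n.+1%:R) \in `[- (pi / 2), (pi / 2) : R].
  by move=> /omega_angle/andP[h1 h2]; rewrite in_itv /= !ltW // (lt_trans _ h1) //
    oppr_lt0 divr_gt0.
rewrite pnatr_eq0 !itv // => /(_ isT isT isT) /(mulIf _).
rewrite invr_eq0 mulf_neq0 ?pnatr_eq0 // => /(_ isT)/(mulIf _).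
by rewrite gt_eqF // => /(_ isT)/eqP; rewrite eqr_nat => /eqP.
Qed.

(** Together with [stiffness_cost], the coefficients [a] and [K] of the trace [a / v + K v]. *)
Definition damping_cost n p s : R := \sum_(m < n | (m < s)%N) 2 / damping n p m.+1 ^+ 2.

Definition stiffness_cost n p s : R :=
  \sum_(m < n | (m < s)%N)
    cost (fun i : 'I_n => omega n i.+1 ^+ 2) (fun i : 'I_n => damping n p i.+1 ^+ 2) m.

Lemma omega_sub_neq0 n (i j : 'I_n) :
  i != j -> omega n i.+1 ^+ 2 - omega n j.+1 ^+ 2 != 0 :> R.
Proof.
move=> ij; have [wi wj] : 0 < omega n i.+1 :> R /\ 0 < omega n j.+1 :> R.
  by rewrite !omega_gt0 /=.
rewrite subr_eq0 eqrXn2 ?ltW //; apply: contra_neq ij => e.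
by apply/val_inj/succn_inj; apply: omega_inj e => /=.
Qed.

Lemma Xsol_trace n p v s : admissible p n -> 0 < v ->
  \tr (Xsol n p v s) = damping_cost n p s / v + stiffness_cost n p s * v.
Proof.
move=> adm v0; pose w i : R := omega n i.+1; pose c i := damping n p i.+1.
have wn (i : 'I_n) : w i != 0 by rewrite gt_eqF // omega_gt0 /=.
have cn (i : 'I_n) : c i != 0 by apply: adm => /=.
have ZE : Zmx n s = dblock (fun i : 'I_n => (i < s)%:R) :> 'M[R]_(n + n).
  rewrite /Zmx /dblock (_ : pid_mx s = diag_mx (\row_i ((i : 'I_n) < s)%:R)) //.
  by apply/matrixP => i j; rewrite !mxE val_eqE; case: eqVneq => // ->.
have v1 : v != 0 by rewrite gt_eqF.
have ex := @sol_solves R n w c wn cn (@omega_sub_neq0 n) v (fun i => (i < s)%:R) v1.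
(* The explicit solution shows that the set is nonempty, so [xget] returns a solution and not its
   default 0. *)
have /xgetPex : lyapunov_sols n p v s !=set0.
  by exists (sol w c v (fun i : 'I_n => (i < s)%:R)); rewrite /lyapunov_sols /= ZE.
move=> /(_ 0); rewrite -/(Xsol n p v s) /lyapunov_sols /= ZE.
move=> /(@sol_trace_linear R n w c wn cn (@omega_sub_neq0 n) _ _ _ v1) ->.
rewrite /damping_cost /stiffness_cost !mulr_suml -big_split /= big_mkcond [RHS]big_mkcond.
apply: eq_bigr => m _; rewrite (@sol_trace R n w c wn cn (@omega_sub_neq0 n)) //.
by case: ifP => _; rewrite ?mul1r ?mul0r.
Qed.

Lemma amgm_div (a k v : R) : 0 <= a -> 0 <= k -> 0 < v ->
  2 * Num.sqrt (a * k) <= a / v + k * v.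
Proof.
move=> a0 k0 v0; have -> : a / v + k * v = (a + k * v ^+ 2) / v by field; rewrite gt_eqF.
rewrite ler_pdivlMr // sqrtrM //.
rewrite -[a in leRHS]sqr_sqrtr // -[k in leRHS]sqr_sqrtr // -subr_ge0.
by rewrite (_ : _ - _ = (Num.sqrt a - Num.sqrt k * v) ^+ 2) ?sqr_ge0 //; ring.
Qed.

Lemma amgm_div_eq (a k : R) : 0 < a -> 0 < k ->
  a / (Num.sqrt a / Num.sqrt k) + k * (Num.sqrt a / Num.sqrt k) = 2 * Num.sqrt (a * k).
Proof.
move=> a0 k0; rewrite sqrtrM ?ltW // -{1}(sqr_sqrtr (ltW a0)) -{2}(sqr_sqrtr (ltW k0)).
by field; rewrite !gt_eqF ?sqrtr_gt0.
Qed.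

Lemma damping_cost_gt0 n p s : admissible p n -> (0 < s < n)%N -> 0 < damping_cost n p s.
Proof.
move=> adm /andP[s0 sn]; case: n sn adm => // n sn adm.
rewrite /damping_cost (bigD1 ord0) //=.
have h (m : 'I_n.+1) : 0 < 2 / damping n.+1 p m.+1 ^+ 2.
  by rewrite divr_gt0 // exprn_even_gt0 //= adm /=.
by apply: ltr_pwDl; [exact: (h ord0)|apply: sumr_ge0 => i _; exact/ltW].
Qed.

Lemma mode_cost_ge n p (m : 'I_n) : admissible p n ->
  3 / 8 * (damping n p m.+1 ^+ 2 / omega n m.+1 ^+ 2) <=
  cost (fun i : 'I_n => omega n i.+1 ^+ 2) (fun i : 'I_n => damping n p i.+1 ^+ 2) m.
Proof.
move=> adm; apply: cost_ge => [i|i|i im]; last exact: omega_sub_neq0.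
  by rewrite exprn_gt0 ?omega_gt0 /=.
by rewrite exprn_even_gt0 //= adm /=.
Qed.

(** Every mode has nonnegative cost by [mode_cost_ge], so the first one alone is a lower bound. It
    yields positivity, and later keeps [K / N] away from 0 at a node. *)
Lemma stiffness_cost_ge n p s : admissible p n -> (0 < s < n)%N ->
  3 / 8 * (damping n p 1 ^+ 2 / omega n 1 ^+ 2) <= stiffness_cost n p s.
Proof.
move=> adm /andP[s0 sn]; case: n sn adm => // n sn adm.
rewrite /stiffness_cost (bigD1 ord0) //= ler_wpDr ?(mode_cost_ge ord0) //.
apply: sumr_ge0 => m _; apply: le_trans (mode_cost_ge m adm).
by rewrite mulr_ge0 ?divr_ge0 ?sqr_ge0.
Qed.

Lemma stiffness_cost_gt0 n p s : admissible p n -> (0 < s < n)%N -> 0 < stiffness_cost n p s.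
Proof.
move=> adm sn; apply: lt_le_trans (stiffness_cost_ge adm sn).
have n0 : (1 <= 1 <= n)%N by case/andP: sn => + /ltnW; exact: leq_trans.
by rewrite mulr_gt0 ?divr_gt0 ?exprn_even_gt0 //= ?adm // gt_eqF // omega_gt0.
Qed.

Lemma vopt_trace n p s : admissible p n -> (0 < s < n)%N ->
  \tr (Xsol n p (vopt n p s) s) =
  2 * Num.sqrt (damping_cost n p s * stiffness_cost n p s).
Proof.
move=> adm sn; have a0 := damping_cost_gt0 adm sn; have k0 := stiffness_cost_gt0 adm sn.
set a := damping_cost _ _ _ in a0 *; set k := stiffness_cost _ _ _ in k0 *.
pose v := Num.sqrt a / Num.sqrt k.
have v0 : 0 < v by rewrite divr_gt0 ?sqrtr_gt0.
(* The viscosity [v] attains the arithmetic-geometric mean bound, so a minimizer exists; the one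
   chosen by [xget] has the same trace, by minimality on one side and the bound on the other. *)
have /xgetPex : optimal_viscosities n p s !=set0.
  exists v; split => // u u0; rewrite !Xsol_trace // amgm_div_eq //.
  by rewrite amgm_div ?ltW.
move=> /(_ 0); rewrite -/(vopt n p s) => -[u0 /(_ _ v0)].
rewrite !Xsol_trace // amgm_div_eq // => le; apply/eqP; rewrite eq_le le.
by rewrite amgm_div ?ltW.
Qed.

End Viscosity.

(** * Sine estimates and limits of sums of growing length *)

Section Asymptotics.
Context {R : realType}.
Set Implicit Arguments.
Unset Strict Implicit.
Implicit Types (n s j : nat) (p v : R).

Lemma cvg_exprn (f : nat -> R) (a : R) k :
  f n @[n --> \oo] --> a -> f n ^+ k @[n --> \oo] --> a ^+ k.
Proof. by move=> fa; apply: (cvg_comp _ (fun y : R => y ^+ k) fa); exact: exprn_continuous. Qed.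

Lemma sin_mulcos_bounds (x : R) : 0 <= x <= pi / 2 -> x * cos x <= sin x <= x.
Proof.
move=> /andP[]; rewrite le_eqVlt => /predU1P[<- _|x0 x2]; first by rewrite sin0 mul0r lexx.
have := @MVT R sin cos 0 x x0.
case=> [|y]; first by apply/continuous_subspaceT/continuous_sin.
rewrite in_itv /= => /andP[y0 yx]; rewrite sin0 !subr0 => ->.
have pi0 := pi_gt0 R.
have cyx : cos x <= cos y.
  rewrite ltW // ltr_cos ?in_itv //=; apply/andP; split; lra.
by rewrite mulrC ler_wpM2r ?(ltW x0) //= ler_piMl ?cos_le1 // ltW.
Qed.

(** By the double angle formula [sin x = 2 sin (x / 2) cos (x / 2) >= x cos (x / 2) ^ 2], and [cos
    (x / 2) ^ 2 = (1 + cos x) / 2 >= 1 / 2]. *)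
Lemma sin_ge_half (x : R) : 0 <= x <= pi / 2 -> x / 2 <= sin x.
Proof.
move=> /andP[x0 x2]; have hx : 0 <= x / 2 <= pi / 2.
  by rewrite divr_ge0 //=; have := pi_gt0 R; lra.
have /andP[h _] := sin_mulcos_bounds hx.
have c0 : 0 <= cos x by rewrite cos_ge0_pihalf // x2 andbT; have := pi_gt0 R; lra.
have ch : 0 <= cos (x / 2).
  by rewrite cos_ge0_pihalf //; have := pi_gt0 R; lra.
have xE : x = (x / 2) *+ 2 by rewrite -mulr_natr divfK.
rewrite [in leRHS]xE sin_mulr2n; rewrite xE cos_mulr2n in c0.
have : cos (x / 2) * (x / 2 * cos (x / 2)) <= cos (x / 2) * sin (x / 2).
  by rewrite ler_wpM2l.
nra.
Qed.

Lemma cvg_inv_succ (a : R) : a / n.+1%:R @[n --> \oo] --> 0.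
Proof. by rewrite -(mulr0 a); apply: cvgMl_tmp; exact: cvg_harmonic. Qed.

Lemma cvg_mul_sin (a : R) : 0 <= a ->
  n.+1%:R * sin (a / n.+1%:R) @[n --> \oo] --> a.
Proof.
move=> a0; apply: (@squeeze_cvgr _ _ _ _ (fun n => a * cos (a / n.+1%:R)) (fun=> a)).
- have small : \forall n \near \oo, a / n.+1%:R <= pi / 2.
    apply: (cvgr_le _ (cvg_inv_succ a)); have := pi_gt0 R; lra.
  near=> n; have n0 : 0 < (n.+1%:R : R) by [].
  have h : 0 <= a / n.+1%:R <= pi / 2 by rewrite divr_ge0 //=; near: n.
  have aE : a = n.+1%:R * (a / n.+1%:R) by rewrite mulrC divfK ?gt_eqF.
  have /andP[h1 h2] := sin_mulcos_bounds h.
  have := ler_wpM2l (ltW n0) h2; rewrite -aE => ->; rewrite andbT.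
  by have := ler_wpM2l (ltW n0) h1; rewrite mulrA -aE.
- rewrite -[X in _ --> X]mulr1 -[X in _ --> a * X]cos0; apply: cvgMl_tmp.
  by apply: continuous_cvg; [exact: continuous_cos|exact: cvg_inv_succ].
- exact: cvg_cst.
Unshelve. all: by end_near. Qed.

(** Beyond a fixed [J] the terms are controlled uniformly in [n] by the tail of [G], and the
    finitely many others converge one by one. *)
Lemma tannery (F : nat -> nat -> R) (f G : nat -> R) :
  cvgn (series G) -> (forall n j, `|F n j| <= G j) ->
  (forall j, F n j @[n --> \oo] --> f j) ->
  exists y : R, (\sum_(j < n) F n j) @[n --> \oo] --> y.
Proof.
move=> cG FG Ff.
have G0 j : 0 <= G j by apply: le_trans (FG 0 j).
have fG j : `|f j| <= G j.
  apply: (cvgr_to_le (cvg_norm (Ff j))).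
  by apply: nearW => n; exact: FG.
have cf : cvgn (series f).
  by apply/normed_cvg/(series_le_cvg _ _ fG).
exists (limn (series f)); rewrite -[X in _ --> X]add0r.
have -> : (fun n => \sum_(j < n) F n j) = (fun n => \sum_(j < n) (F n j - f j) + series f n).
  by apply/funext => n; rewrite sumrB seriesEord /= subrK.
apply: cvgD => //; apply/cvgr0Pnorm_le => e e0.
(* Being within [e / 8] of the limit at both [J] and [n] bounds the tail of [G] by [e / 4]. Each
   difference is at most [2 G j], so the tail contributes at most [e / 2], as does the head. *)
have /cvgrPdist_le/(_ (e / 8)) := cG; case=> [|J _ HJ]; first by rewrite divr_gt0.
have head : (\sum_(j < J) `|F n j - f j|) @[n --> \oo] --> 0.
  rewrite [X in _ --> X](_ : 0 = \sum_(j < J) 0); last by rewrite big1.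
  apply: (@cvg_big R _ +%R 0 _ (@add_continuous R)) => j _; rewrite -(normr0 R); apply: cvg_norm.
  by rewrite -(subrr (f j)); apply: cvgB => //; exact: cvg_cst.
have headle : \forall n \near \oo, \sum_(j < J) `|F n j - f j| <= e / 2.
  by apply: (cvgr_le _ head); rewrite divr_gt0.
near=> n; have Jn : (J <= n)%N by near: n; exact: nbhs_infty_ge.
have tail : series G n - series G J <= e / 4.
  have := HJ J (leqnn J); have := HJ n Jn; rewrite /= !ler_norml.
  by move=> /andP[? ?] /andP[? ?]; lra.
apply: le_trans (ler_norm_sum _ _ _) _.
rewrite -(big_mkord xpredT (fun j => `|F n j - f j|)) (big_cat_nat (leq0n J) Jn) /= big_mkord.
have : \sum_(J <= j < n) `|F n j - f j| <= 2 * (series G n - series G J).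
  rewrite sub_series_geq // mulr_sumr; apply: ler_sum => j _.
  by rewrite mulr_natl mulr2n (le_trans (ler_normB _ _)) // lerD.
have : \sum_(j < J) `|F n j - f j| <= e / 2 by near: n.
by lra.
Unshelve. all: by end_near. Qed.

(** The majorant [C / ((j + 1) (j + 2))], written as a telescoping difference. *)
Lemma cvg_series_inv_square (C : R) :
  cvgn (series (fun j => C * (j.+1%:R^-1 - j.+2%:R^-1))).
Proof.
rewrite (_ : (fun j => _) = telescope (fun j => - (C / j.+1%:R))); last first.
  by apply/funext => j; rewrite /telescope /= opprK mulrBr addrC.
rewrite telescopeK; apply/cvg_ex; exists (- 0 - - (C / 1)); apply: cvgB; last exact: cvg_cst.
by apply: cvgN; exact: cvg_inv_succ.
Qed.

(* As [divsum], but with indices in [nat], so that [l], [x] and [m] do not depend on [n]. *)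
Definition nsum n (l x : nat -> R) m e : R :=
  \sum_(j < n | j != m :> nat) x j / (l j - l m) ^+ e.

(** The terms up to [J] converge individually. Beyond [J] the gap is at least
    [(j + 1) (j + 2) / 4 >= 1], hence so is each of its positive powers, and Tannery's theorem
    applies. *)
Lemma nsum_cvg (l x : nat -> nat -> R) (linf xinf : nat -> R) m e (C : R) J :
  (forall j, l n j @[n --> \oo] --> linf j) ->
  (forall j, x n j @[n --> \oo] --> xinf j) ->
  (forall j, j != m -> linf j - linf m != 0) ->
  (forall n j, `|x n j| <= C) ->
  (forall n j, (J < j < n)%N -> j.+1%:R * j.+2%:R / 4 <= l n j - l n m) ->
  exists y : R, nsum n (l n) (x n) m e.+1 @[n --> \oo] --> y.
Proof.
move=> cl cx ne xC lb.
have C0 : 0 <= C by apply: le_trans (xC 0 0).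
pose t n j := if j != m then x n j / (l n j - l n m) ^+ e.+1 else 0.
pose tinf j := if j != m then xinf j / (linf j - linf m) ^+ e.+1 else 0.
have ct j : t n j @[n --> \oo] --> tinf j.
  rewrite /t /tinf; case: ifP => jm; last exact: cvg_cst.
  apply: cvgM; first exact: cx.
  apply: cvgV; first by rewrite expf_neq0 // ne.
  by apply: cvg_exprn; exact: cvgB.
(* Truncating to [J < j < n], where the gap bound is available, makes the domination hold for all
   [n] and [j]. *)
pose F n j := if (J < j < n)%N then t n j else 0.
have [y hy] : exists y : R, (\sum_(j < n) F n j) @[n --> \oo] --> y.
  apply: (@tannery F (fun j => if (J < j)%N then tinf j else 0) _
    (@cvg_series_inv_square (4 * C))) => [n j|j].
    have G0 : 0 <= 4 * C * (j.+1%:R^-1 - j.+2%:R^-1) :> R.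
      by rewrite !mulr_ge0 // subr_ge0 lef_pV2 ?posrE ?ltr0n // ler_nat.
    rewrite /F; case: ifP => [Jj|_]; last by rewrite normr0.
    rewrite /t; case: ifP => [jm|_]; last by rewrite normr0.
    have := lb _ _ Jj; set d := l n j - l n m => hd.
    have j1 : 1 <= (j%:R : R).
      rewrite (ler_nat _ 1%N); case/andP: Jj => + _; exact: leq_ltn_trans.
    have d1 : 1 <= d.
      apply: le_trans hd; rewrite -[j.+2%:R]natr1 -[j.+1%:R]natr1; nra.
    have -> : j.+1%:R^-1 - j.+2%:R^-1 = (j.+1%:R * j.+2%:R)^-1 :> R.
      have j1n : j.+1%:R + 1 != 0 :> R by rewrite natr1 pnatr_eq0.
      have j0n : j.+1%:R != 0 :> R by rewrite pnatr_eq0.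
      rewrite -[j.+2%:R]natr1; move: j.+1%:R j0n j1n => z z0 z1.
      by field; rewrite z0 z1.
    have d0 : 0 < d by apply: lt_le_trans d1.
    have dE : `|d ^+ e.+1| = d ^+ e.+1 by rewrite ger0_norm // exprn_ge0 // ltW.
    rewrite normrM normfV dE (mulrC 4) -mulrA ler_pM ?invr_ge0 ?exprn_ge0 ?(ltW d0) //.
    apply: (@le_trans _ _ d^-1).
      rewrite lef_pV2 ?posrE ?exprn_gt0 // exprS ler_peMr ?exprn_ege1 ?(ltW d0) //.
    rewrite -[4]invrK -invfM lef_pV2 ?posrE // 1?mulrC //.
  rewrite /F; case: ifP => Jj /=; last exact: cvg_cst.
  apply: cvg_trans (ct j); apply: near_eq_cvg.
  by near=> n; rewrite (_ : (j < n)%N) //; near: n; exact: nbhs_infty_gt.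
have hz : (\sum_(j < J.+1) t n j) @[n --> \oo] --> \sum_(j < J.+1) tinf j.
  by apply: (@cvg_big R _ +%R 0 _ (@add_continuous R)) => j _; exact: ct.
exists (\sum_(j < J.+1) tinf j + y).
apply: cvg_trans (cvgD hz hy); apply: near_eq_cvg; near=> n.
have Jn : (J.+1 <= n)%N by near: n; exact: nbhs_infty_ge.
suff -> : nsum n (l n) (x n) m e.+1 =
    \sum_(j < J.+1) t n j + \sum_(j < n) F n j by [].
have -> : nsum n (l n) (x n) m e.+1 = \sum_(0 <= j < n) t n j.
  by rewrite /nsum big_mkcond big_mkord.
rewrite -(big_mkord xpredT (t n)) -(big_mkord xpredT (F n)).
rewrite !(big_cat_nat (leq0n J.+1) Jn) /=.
rewrite [X in _ = _ + (X + _)]big1_seq ?add0r; last first.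
  by move=> j; rewrite mem_index_iota /F => /andP[_ /andP[_ jJ]]; rewrite ltnNge -ltnS jJ.
by congr (_ + _); apply: eq_big_nat => j /andP[Jj jn]; rewrite /F Jj jn.
Unshelve. all: by end_near. Qed.

End Asymptotics.

(** * Rescaled frequencies and dampings *)

Section Scaling.
Context {R : realType}.
Set Implicit Arguments.
Unset Strict Implicit.
Implicit Types (n s j m : nat) (p v : R).

Lemma natS_neq0 n : n.+1%:R != 0 :> R.
Proof. by rewrite pnatr_eq0. Qed.

(** The rescaled sequences number the modes from 0: index [j] is mode [j + 1]. *)
Definition scaled_freq n j : R := (n.+1%:R * omega n j.+1) ^+ 2.

Definition scaled_damping p n j : R := n.+1%:R * damping n p j.+1 ^+ 2.

Lemma scaled_freqE n j :
  scaled_freq n j = (2 * (n.+1%:R * sin (j.+1%:R * pi / 2 / n.+1%:R))) ^+ 2.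
Proof. by rewrite /scaled_freq /omega invfM !mulrA (mulrC 2). Qed.

Lemma scaled_freq_cvg j : scaled_freq n j @[n --> \oo] --> ((j.+1%:R * pi) ^+ 2 : R).
Proof.
rewrite (_ : (fun n => scaled_freq n j) = (fun n =>
  (2 * (n.+1%:R * sin (j.+1%:R * pi / 2 / n.+1%:R))) ^+ 2)); last first.
  by apply/funext => n; exact: scaled_freqE.
apply: cvg_exprn.
rewrite [X in _ --> X](_ : _ = 2 * (j.+1%:R * pi / 2)); last by field.
apply: cvgMl_tmp; apply: cvg_mul_sin.
by rewrite divr_ge0 // mulr_ge0 // pi_ge0.
Qed.

Lemma scaled_freq_le n m : (m < n)%N -> scaled_freq n m <= (m.+1%:R * pi) ^+ 2 :> R.
Proof.
move=> mn; have /(@omega_angle R)/andP[h0 h1] : (1 <= m.+1 <= n)%N by [].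
have hx : 0 <= (m.+1%:R : R) * pi / (2 * n.+1%:R) <= pi / 2 by rewrite !ltW.
have /andP[_ h] := sin_mulcos_bounds hx.
have w0 : 0 <= n.+1%:R * omega n m.+1 :> R by apply: mulr_ge0 => //; rewrite ltW // omega_gt0.
have p0 := pi_ge0 R.
rewrite lerXn2r ?nnegrE ?[0 <= _ * pi]mulr_ge0 //.
have -> : m.+1%:R * pi = n.+1%:R * (2 * (m.+1%:R * pi / (2 * n.+1%:R))) :> R.
  by move: n.+1%:R (natS_neq0 n) => N N0; field.
by rewrite !ler_wpM2l.
Qed.

Lemma scaled_freq_ge n j : (j < n)%N -> (j.+1%:R * pi / 2) ^+ 2 <= scaled_freq n j :> R.
Proof.
move=> jn; have /(@omega_angle R)/andP[h0 h1] : (1 <= j.+1 <= n)%N by [].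
have hx : 0 <= (j.+1%:R : R) * pi / (2 * n.+1%:R) <= pi / 2 by rewrite !ltW.
have h := sin_ge_half hx.
have w0 : 0 <= n.+1%:R * omega n j.+1 :> R by apply: mulr_ge0 => //; rewrite ltW // omega_gt0.
have p0 := pi_ge0 R.
rewrite lerXn2r ?nnegrE ?divr_ge0 ?[0 <= _ * pi]mulr_ge0 //.
have -> : j.+1%:R * pi / 2 = n.+1%:R * (2 * (j.+1%:R * pi / (2 * n.+1%:R) / 2)) :> R.
  by move: n.+1%:R (natS_neq0 n) => N N0; field.
by rewrite !ler_wpM2l.
Qed.

(** With [a = j + 1 >= 3 b] and [b = m + 1], the difference is at least [(a pi / 2) ^ 2 - (b pi) ^ 2
    >= 5 / 36 * (a pi) ^ 2]. As [pi >= 2] this is at least [5 / 9 * a ^ 2], which exceeds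
    [a (a + 1) / 4]. *)
Lemma scaled_freq_gap n j m : (3 * m.+1 < j < n)%N ->
  j.+1%:R * j.+2%:R / 4 <= scaled_freq n j - scaled_freq n m :> R.
Proof.
move=> /andP[mj jn].
have mn : (m < n)%N by lia.
have := scaled_freq_ge jn; have := scaled_freq_le mn.
have : 3 * m.+1%:R <= j.+1%:R :> R by rewrite -natrM ler_nat; lia.
have : 1 <= m.+1%:R :> R by rewrite ler1n.
have := pi_ge2 R; rewrite -[j.+2%:R]natr1.
move: (scaled_freq n j) (scaled_freq n m) j.+1%:R m.+1%:R pi => x y a b q q2 b1 ab hy hx.
have q4 : 4 <= q ^+ 2 by nra.
have ab9 : 9 * b ^+ 2 <= a ^+ 2 by nra.
have a5 : a * (a + 1) / 4 <= 5 / 9 * a ^+ 2 by nra.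
have : 5 / 9 * a ^+ 2 <= q ^+ 2 * (5 / 36 * a ^+ 2) by nra.
have : q ^+ 2 * b ^+ 2 <= q ^+ 2 * (a ^+ 2 / 9) by nra.
rewrite !exprMn exprVn in hx hy; lra.
Qed.

Lemma cvg_ratio_succ : n%:R / n.+1%:R @[n --> \oo] --> (1 : R).
Proof.
rewrite (_ : (fun n => _) = (fun n => 1 - 1 / n.+1%:R)); last first.
  by apply/funext => n; rewrite -{1}[n%:R](addrK 1) natr1;
    move: n.+1%:R (natS_neq0 n) => N N0; field.
rewrite -[X in _ --> X]subr0; apply: cvgB; [exact: cvg_cst|exact: cvg_inv_succ].
Qed.

Lemma scaled_dampingE p n j :
  scaled_damping p n j = 2 * sin (j.+1%:R * p * pi * (n%:R / n.+1%:R)) ^+ 2.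
Proof.
rewrite /scaled_damping /damping exprMn sqr_sqrtr ?divr_ge0 // mulrA.
rewrite [n.+1%:R * (2 / _)]mulrCA divff ?natS_neq0 // mulr1; congr (_ * sin _ ^+ 2).
by move: n.+1%:R (natS_neq0 n) => N N0; field.
Qed.

Lemma scaled_damping_cvg p j :
  scaled_damping p n j @[n --> \oo] --> 2 * sin (j.+1%:R * p * pi) ^+ 2.
Proof.
rewrite (_ : (fun n => scaled_damping p n j) = (fun n =>
  2 * sin (j.+1%:R * p * pi * (n%:R / n.+1%:R)) ^+ 2)); last first.
  by apply/funext => n; exact: scaled_dampingE.
apply: cvgMl_tmp; apply: cvg_exprn.
apply: continuous_cvg; first exact: continuous_sin.
by rewrite -[X in _ --> X]mulr1; apply: cvgMl_tmp; exact: cvg_ratio_succ.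
Qed.

Lemma scaled_damping_le2 p n j : `|scaled_damping p n j| <= 2.
Proof.
rewrite scaled_dampingE normrM normrX ger0_norm // ler_piMr // expr_le1 //.
exact: sin_max.
Qed.

Definition ncost n (l x : nat -> R) m : R :=
  4 * l m * nsum n l x m 2 + nsum n l x m 1 + 2 * l m * nsum n l x m 1 ^+ 2 / x m
  + x m * nsum n l (fun=> 1) m 1 + 2 * l m * x m * nsum n l (fun=> 1) m 2
  + x m / (2 * l m).

(** Each term of [cost] is homogeneous of degree 1 in [a] and degree - 1 in [l], so multiplying [a]
    by [N] and [l] by [N ^ 2] divides it by [N]. *)
Lemma cost_scaled p n (m : 'I_n) : damping n p m.+1 != 0 ->
  cost (fun i : 'I_n => omega n i.+1 ^+ 2) (fun i : 'I_n => damping n p i.+1 ^+ 2) m =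
  n.+1%:R * ncost n (scaled_freq n) (scaled_damping p n) m.
Proof.
move=> d0; set N : R := n.+1%:R; have N0 : N != 0 by rewrite pnatr_eq0.
set l := fun i : 'I_n => _; set a := fun i : 'I_n => _.
have w0 : omega n m.+1 != 0 :> R by rewrite gt_eqF // omega_gt0 /=.
have scale (x : 'I_n -> R) (y : nat -> R) k e : (forall i : 'I_n, y i = k * x i) ->
    nsum n (scaled_freq n) y m e = k / N ^+ (2 * e) * divsum l x m e.
  move=> yx; rewrite /nsum /divsum mulr_sumr; apply: eq_bigr => i im.
  have ne := @omega_sub_neq0 R n i m im.
  rewrite yx /scaled_freq /l -/N !exprMn -mulrBr exprMn -exprM.
  by rewrite !invfM; ring.
rewrite /ncost !(scale a (scaled_damping p n) N) // !(scale (fun=> 1) (fun=> 1) 1) ?mulr1 //.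
have [lE aE] : l m = omega n m.+1 ^+ 2 /\ a m = damping n p m.+1 ^+ 2 by [].
rewrite /cost !lE !aE /scaled_damping /scaled_freq -/N muln1 (_ : (2 * 2)%N = 4%N) //.
by clear scale; clearbody N; field; rewrite N0 w0 d0.
Qed.

(** The hypothesis keeps the limit of [scaled_damping p n m], by which [ncost] divides, away from 0.
    The sums converge by [nsum_cvg] with cutoff [J = 3 (m + 1)]. *)
Lemma ncost_cvg p m : sin (m.+1%:R * p * pi) != 0 ->
  exists y : R, ncost n (scaled_freq n) (scaled_damping p n) m @[n --> \oo] --> y.
Proof.
move=> s0.
have ne j : j != m -> (j.+1%:R * pi) ^+ 2 - (m.+1%:R * pi) ^+ 2 != 0 :> R.
  move=> jm; rewrite subr_eq0 eqrXn2 ?mulr_ge0 ?pi_ge0 //.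
  by rewrite (inj_eq (mulIf (lt0r_neq0 (pi_gt0 R)))) eqr_nat eqSS.
have gap n j : (3 * m.+1 < j < n)%N -> _ := @scaled_freq_gap n j m.
have csum e := @nsum_cvg R _ _ _ _ m e 2 _ scaled_freq_cvg (@scaled_damping_cvg p) ne
  (@scaled_damping_le2 p) gap.
have one_cvg (j : nat) : (fun n j : nat => 1 : R) n j @[n --> \oo] --> (1 : R) by exact: cvg_cst.
have one_le (n j : nat) : `|1 : R| <= 1 by rewrite normr1.
have csum1 e := @nsum_cvg R _ (fun _ _ => 1) _ (fun=> 1) m e 1 _
  scaled_freq_cvg one_cvg ne one_le gap.
have [u1 h1] := csum 0%N; have [u2 h2] := csum 1%N.
have [z1 g1] := csum1 0%N; have [z2 g2] := csum1 1%N.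
have lm := @scaled_freq_cvg m; have xm := @scaled_damping_cvg p m.
set L := (_ * _) ^+ 2 in lm; set X := 2 * _ in xm.
have X0 : X != 0 by rewrite mulf_neq0 // expf_neq0.
have L0 : L != 0 by rewrite expf_neq0 // mulf_neq0 ?pnatr_eq0 // gt_eqF // pi_gt0.
exists (4 * L * u2 + u1 + 2 * L * u1 ^+ 2 / X + X * z1 + 2 * L * X * z2 + X / (2 * L)).
have cL k : (k * scaled_freq n m) @[n --> \oo] --> k * L by apply: cvgMl_tmp.
apply: cvgD; last by apply: cvgM => //; apply: cvgV => //; rewrite mulf_neq0.
apply: cvgD; last by apply: cvgM => //; apply: cvgM.
apply: cvgD; last by apply: cvgM.
apply: cvgD; last first.
  apply: cvgM; last exact: cvgV.
  by apply: cvgM => //; exact: cvg_exprn.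
by apply: cvgD => //; apply: cvgM.
Qed.

End Scaling.

(** * Limit of the optimal trace, away from nodes and at nodes *)

Section Limit.
Context {R : realType}.
Set Implicit Arguments.
Unset Strict Implicit.
Implicit Types (n s j m : nat) (p : R).

Lemma damping_cost_scaled p n s : (s < n)%N ->
  damping_cost n p s = n.+1%:R * \sum_(m < s) 2 / scaled_damping p n m.
Proof.
move=> sn; rewrite mulr_sumr.
rewrite (big_ord_widen n (fun m => n.+1%:R * (2 / scaled_damping p n m)) (ltnW sn)).
apply: eq_bigr => m _; rewrite /scaled_damping.
by rewrite [RHS]mulrCA [in RHS]invfM mulVKf // natS_neq0.
Qed.

Lemma stiffness_cost_scaled p n s : admissible p n -> (s < n)%N ->
  stiffness_cost n p s =
  n.+1%:R * \sum_(m < s) ncost n (scaled_freq n) (scaled_damping p n) m.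
Proof.
move=> adm sn; rewrite mulr_sumr.
rewrite (big_ord_widen n
  (fun m => n.+1%:R * ncost n (scaled_freq n) (scaled_damping p n) m) (ltnW sn)).
by apply: eq_bigr => m _; rewrite cost_scaled // adm /=.
Qed.

Lemma vopt_trace_scaled p n s : admissible p n -> (0 < s < n)%N ->
  \tr (Xsol n p (vopt n p s) s) / n%:R =
  (n%:R / n.+1%:R)^-1 * (2 * Num.sqrt ((damping_cost n p s / n.+1%:R)
                                   * (stiffness_cost n p s / n.+1%:R))).
Proof.
move=> adm sn; rewrite vopt_trace // mulrACA -invfM -expr2.
have n0 : n%:R != 0 :> R by rewrite pnatr_eq0; case: n sn {adm} => //; rewrite ltn0 andbF.
rewrite [in RHS]sqrtrM; last first.
  by rewrite mulr_ge0 // ltW ?damping_cost_gt0 ?stiffness_cost_gt0.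
rewrite sqrtrV ?sqr_ge0 // sqrtr_sqr ger0_norm //.
move: (Num.sqrt _) n%:R n0 n.+1%:R (@natS_neq0 R n) => q x x0 y y0.
by field; rewrite x0 y0.
Qed.

Lemma trace_cvg_nonnodal p s : (0 < s)%N -> nonnodal p s ->
  exists y : R, \tr (Xsol n p (vopt n p s) s) / n%:R
    @[n --> within [set n : nat | (s < n)%N /\ admissible p n] \oo] --> y.
Proof.
move=> s0 nn; set D := [set n | _].
have s_neq0 (m : 'I_s) : sin (m.+1%:R * p * pi) != 0 by apply: nn => /=.
have [y hy] := choice (fun m : 'I_s => ncost_cvg (s_neq0 m)).
pose x (m : 'I_s) : R := 2 / (2 * sin (m.+1%:R * p * pi) ^+ 2).
exists (1^-1 * (2 * Num.sqrt ((\sum_m x m) * (\sum_m y m)))).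
pose f n := (n%:R / n.+1%:R)^-1 * (2 * Num.sqrt ((\sum_(m < s) 2 / scaled_damping p n m)
  * (\sum_(m < s) ncost n (scaled_freq n) (scaled_damping p n) m))).
have fc : f n @[n --> \oo] --> 1^-1 * (2 * Num.sqrt ((\sum_m x m) * (\sum_m y m))).
  apply: cvgM; first by apply: cvgV; [rewrite oner_neq0|exact: cvg_ratio_succ].
  apply: cvgMl_tmp; apply: continuous_cvg; first exact: sqrt_continuous.
  apply: cvgM; apply: (@cvg_big R _ +%R 0 _ (@add_continuous R)) => m _ //.
  apply: cvgMl_tmp; apply: cvgV; last exact: scaled_damping_cvg.
  by rewrite mulf_neq0 // expf_neq0.
(* The closed form [f] converges along all [n]; it is identified with the normalized trace at the
   admissible [n > s], hence the restriction of the filter. *)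
have fD := @cvg_within_filter _ _ _ _ _ _ D fc.
apply: (cvg_trans _ (fD _)); apply: near_eq_cvg.
rewrite near_withinE; near=> n => -[sn adm].
rewrite vopt_trace_scaled ?s0 // damping_cost_scaled // stiffness_cost_scaled //.
by rewrite ![n.+1%:R * _]mulrC !mulfK ?natS_neq0.
Unshelve. all: by end_near. Qed.

(** The mode with a node at [p] makes [a / N] tend to infinity, while the first mode, which has no
    node in [(0, 1)], bounds [K / N] from below. *)
Lemma trace_cvgy_nodal p s : 0 < p < 1 -> ~ nonnodal p s ->
  \tr (Xsol n p (vopt n p s) s) / n%:R
    @[n --> within [set n : nat | (s < n)%N /\ admissible p n] \oo] --> +oo.
Proof.
move=> /andP[p0 p1] /existsNP[[|m]] /not_implyP[] // ms /negP/negPn/eqP sm.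
apply/cvgryPge => A.
have sp : 0 < sin (1%:R * p * pi).
  have := pi_gt0 R => pi0; rewrite mul1r sin_gt0_pi // mulr_gt0 //=.
  by rewrite gtr_pMl.
(* Half the limit of the lower bound that the first mode gives for [K / N], so that [K / N >= d]
   eventually. *)
pose d : R := 3 / 8 * (2 * sin (1%:R * p * pi) ^+ 2 / (1%:R * pi) ^+ 2) / 2.
have d0 : 0 < d.
  by rewrite /d !mulr_gt0 ?invr_gt0 ?exprn_gt0 ?mulr_gt0 ?pi_gt0.
have c0 : 3 / 8 * (scaled_damping p n 0 / scaled_freq n 0) @[n --> \oo] --> d * 2.
  rewrite /d divfK //; apply: cvgMl_tmp; apply: cvgM.
    exact: (@scaled_damping_cvg _ p 0).
  apply: cvgV; last exact: (@scaled_freq_cvg _ 0).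
  by rewrite expf_neq0 // mulf_neq0 // gt_eqF // pi_gt0.
have cm := @scaled_damping_cvg _ p m; rewrite sm expr0n mulr0 in cm.
(* Chosen so that [2 / e * d = A ^ 2 + 1]: once the damping at the node is below [e], the product of
   [a / N] and [K / N] exceeds [A ^ 2]. *)
pose e := 2 * d / (A ^+ 2 + 1).
have A1 : 0 < A ^+ 2 + 1 by rewrite ltr_wpDl ?sqr_ge0.
have e0 : 0 < e by rewrite divr_gt0 // mulr_gt0.
have near_d : \forall n \near \oo, d <= 3 / 8 * (scaled_damping p n 0 / scaled_freq n 0).
  by apply: (cvgr_ge _ c0); rewrite ltr_pMr // ltr1n.
have near_e : \forall n \near \oo, scaled_damping p n m <= e by apply: (cvgr_le _ cm).
rewrite near_withinE; near=> n => -[sn adm].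
have s0 : (0 < s)%N by case/andP: ms => _; exact: leq_trans.
have n0 : (0 < n)%N by apply: leq_trans sn.
rewrite vopt_trace_scaled ?s0 //.
have K_ge : d <= stiffness_cost n p s / n.+1%:R.
  apply: (@le_trans _ _ (3 / 8 * (scaled_damping p n 0 / scaled_freq n 0))); first by near: n.
  rewrite ler_pdivlMr ?ltr0n //; apply: le_trans (stiffness_cost_ge adm _); last by rewrite s0.
  rewrite le_eqVlt; apply/orP; left; apply/eqP.
  have w0 : omega n 1 != 0 :> R by rewrite gt_eqF // omega_gt0.
  rewrite /scaled_damping /scaled_freq; move: n.+1%:R (@natS_neq0 R n) => N N0.
  by field; rewrite N0 w0.
have B0 j : (j < s)%N -> 0 < scaled_damping p n j.
  move=> js; rewrite mulr_gt0 ?ltr0n // exprn_even_gt0 //= adm //=.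
  exact: ltn_trans sn.
have a_ge : (A ^+ 2 + 1) / d <= damping_cost n p s / n.+1%:R.
  rewrite damping_cost_scaled // [leRHS]mulrC mulKf ?natS_neq0 //.
  have ms' : (m < s)%N by case/andP: ms.
  rewrite (bigD1 (Ordinal ms')) //= ler_wpDr //.
    by apply: sumr_ge0 => j _; rewrite divr_ge0 // ltW // B0.
  have -> : (A ^+ 2 + 1) / d = 2 / e by rewrite /e; field; rewrite !gt_eqF.
  by rewrite ler_pM2l // lef_pV2 ?posrE ?B0 //; near: n.
have prod : A ^+ 2 <= damping_cost n p s / n.+1%:R * (stiffness_cost n p s / n.+1%:R).
  apply: (@le_trans _ _ ((A ^+ 2 + 1) / d * d)); first by rewrite divfK ?gt_eqF // lerDl.
  by rewrite ler_pM // ?ltW // divr_gt0.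
have ratio : 1 <= (n%:R / n.+1%:R)^-1 :> R.
  by rewrite invfM invrK mulrC ler_pdivlMr ?ltr0n // mul1r ler_nat.
apply: le_trans (ler_norm A) _; rewrite -sqrtr_sqr.
apply: (@le_trans _ _ (2 * Num.sqrt (damping_cost n p s / n.+1%:R *
                                     (stiffness_cost n p s / n.+1%:R)))).
  apply: (@le_trans _ _ (2 * Num.sqrt (A ^+ 2))); first by rewrite ler_peMl ?sqrtr_ge0 // ler1n.
  by rewrite ler_pM2l // ler_wsqrtr.
by rewrite ler_peMl // mulr_ge0 // sqrtr_ge0.
Unshelve. all: by end_near. Qed.

End Limit.

(** * Choice of the limit as a function of position and number of modes *)

Theorem theorem1 (R : realType) :
  exists eta1 : R -> nat -> \bar R,
    forall (s : nat) (p : R), (1 <= s)%N -> 0 < p -> p < 1 ->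
      ((\tr (Xsol n p (vopt n p s) s) / n%:R)%:E
         @[n --> within [set n : nat | (s < n)%N /\ admissible p n] \oo]
         --> eta1 p s)
      /\ (nonnodal p s -> eta1 p s \is a fin_num).
Proof.
suff /choice[eta1 h] : forall ps : R * nat, exists y : \bar R,
    (1 <= ps.2)%N -> 0 < ps.1 -> ps.1 < 1 ->
      ((\tr (Xsol n ps.1 (vopt n ps.1 ps.2) ps.2) / n%:R)%:E
         @[n --> within [set n : nat | (ps.2 < n)%N /\ admissible ps.1 n] \oo] --> y)
      /\ (nonnodal ps.1 ps.2 -> y \is a fin_num).
  by exists (fun p s => eta1 (p, s)) => s p; exact: (h (p, s)).
(* Here and in the last case 0 is a placeholder for pairs outside the hypotheses; at a node the
   limit is [+oo]. *)
case=> p s /=; case: (leqP 1 s) => s0; last by exists 0%E.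
have [nn|nod] := pselect (nonnodal p s).
  have [y hy] := trace_cvg_nonnodal s0 nn.
  by exists y%:E => _ _ _; split=> //; apply: cvg_EFin => //; exact: nearW.
have [/andP[p0 p1]|p01] := boolP (0 < p < 1).
  exists +oo%E => _ _ _; split=> //; apply/cvgeryP; apply: trace_cvgy_nodal => //.
  by rewrite p0.
by exists 0%E => _ p0 p1; rewrite p0 p1 in p01.
Qed.
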